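(* Let $\lambda_l\in\mathbb{H}$ be a left eigenvalue of a matrix $\mathbf{A}=(a_{ij})\in\mathbb{H}^{m\times m}$. Then there exist nonnegative real numbers $\mathfrak{m}\ge 0$ and $\mathfrak{M}\ge 0$ such that $\mathfrak{m}\le\|\lambda_l\|\le\mathfrak{M}$.
   Context: $\mathbb{H}$ denotes the quaternions and $\mathbb{H}^{m\times n}$ the set of $m\times n$ quaternion matrices. For $q=[q]_0+[q]_1\hbar+[q]_2\jmath+[q]_3\kappa$ with real coefficients $[q]_0,[q]_1,[q]_2,[q]_3$ and $\hbar^2=\jmath^2=\kappa^2=\hbar\jmath\kappa=-1$, the norm is $\|q\|=\sqrt{[q]_0^2+[q]_1^2+[q]_2^2+[q]_3^2}$. A quaternion $\lambda_l$ is a left eigenvalue of $\mathbf{A}\in\mathbb{H}^{m\times m}$ if $\mathbf{A}\mathbf{x}=\lambda_l\mathbf{x}$ for some nonzero $\mathbf{x}\in\mathbb{H}^{m\times 1}$. *)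

(* Defs.v *)
From HB Require Import structures.
From mathcomp Require Import all_boot all_order all_algebra.
From mathcomp Require Import reals.
From mathcomp Require Import ring.

Set Implicit Arguments.
Unset Strict Implicit.
Unset Printing Implicit Defensive.

Import Order.TTheory GRing.Theory Num.Theory.
Local Open Scope ring_scope.

Record quat (R : Type) : Type :=
  Quat { quat0 : R; quat1 : R; quat2 : R; quat3 : R }.

Section QuatEncoding.
Variable R : Type.

Definition tuple_of_quat (q : quat R) : R * R * R * R :=
  (quat0 q, quat1 q, quat2 q, quat3 q).

Definition quat_of_tuple (t : R * R * R * R) : quat R :=
  let: (a, b, c, d) := t in Quat a b c d.

Lemma tuple_of_quatK : cancel tuple_of_quat quat_of_tuple.
Proof. by case. Qed.

End QuatEncoding.

HB.instance Definition _ (R : choiceType) :=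
  Choice.copy (quat R) (can_type (@tuple_of_quatK R)).

Section QuatRing.
Variable R : comNzRingType.
Implicit Types p q r : quat R.

Definition quat_add p q : quat R :=
  Quat (quat0 p + quat0 q) (quat1 p + quat1 q)
       (quat2 p + quat2 q) (quat3 p + quat3 q).

Definition quat_opp p : quat R :=
  Quat (- quat0 p) (- quat1 p) (- quat2 p) (- quat3 p).

Definition quat_zero : quat R := Quat 0 0 0 0.

Definition quat_one : quat R := Quat 1 0 0 0.

(* The Hamilton product: the bilinear extension of the multiplication table of
   1, hbar, jmath, kappa forced by
   hbar^2 = jmath^2 = kappa^2 = hbar jmath kappa = -1 (see [quat_unitsE]). *)
Definition quat_mul p q : quat R :=
  let: Quat a b c d := p in
  let: Quat a' b' c' d' := q in
  Quat (a * a' - b * b' - c * c' - d * d')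
       (a * b' + b * a' + c * d' - d * c')
       (a * c' - b * d' + c * a' + d * b')
       (a * d' + b * c' - c * b' + d * a').

Lemma quat_addA : associative quat_add.
Proof. by move=> [????] [????] [????]; congr Quat => /=; ring. Qed.

Lemma quat_addC : commutative quat_add.
Proof. by move=> [????] [????]; congr Quat => /=; ring. Qed.

Lemma quat_add0 : left_id quat_zero quat_add.
Proof. by move=> [????]; congr Quat => /=; ring. Qed.

Lemma quat_addN : left_inverse quat_zero quat_opp quat_add.
Proof. by move=> [????]; congr Quat => /=; ring. Qed.

HB.instance Definition _ :=
  GRing.isZmodule.Build (quat R) quat_addA quat_addC quat_add0 quat_addN.

Lemma quat_mulA : associative quat_mul.
Proof. by move=> [????] [????] [????]; congr Quat => /=; ring. Qed.

Lemma quat_mul1l : left_id quat_one quat_mul.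
Proof. by move=> [????]; congr Quat => /=; ring. Qed.

Lemma quat_mul1r : right_id quat_one quat_mul.
Proof. by move=> [????]; congr Quat => /=; ring. Qed.

Lemma quat_mulDl : left_distributive quat_mul quat_add.
Proof. by move=> [????] [????] [????]; congr Quat => /=; ring. Qed.

Lemma quat_mulDr : right_distributive quat_mul quat_add.
Proof. by move=> [????] [????] [????]; congr Quat => /=; ring. Qed.

Lemma quat_one_neq0 : quat_one != 0 :> quat R.
Proof. by apply/eqP => -[] /eqP; rewrite oner_eq0. Qed.

HB.instance Definition _ :=
  GRing.Zmodule_isNzRing.Build (quat R)
    quat_mulA quat_mul1l quat_mul1r quat_mulDl quat_mulDr quat_one_neq0.

Definition qreal (a : R) : quat R := Quat a 0 0 0.
Definition qhbar : quat R := Quat 0 1 0 0.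
Definition qjmath : quat R := Quat 0 0 1 0.
Definition qkappa : quat R := Quat 0 0 0 1.

Lemma quatE q :
  q = qreal (quat0 q) + qreal (quat1 q) * qhbar
      + qreal (quat2 q) * qjmath + qreal (quat3 q) * qkappa.
Proof. by case: q => a b c d; congr Quat => /=; ring. Qed.

Lemma quat_unitsE :
  [/\ qhbar ^+ 2 = -1, qjmath ^+ 2 = -1, qkappa ^+ 2 = -1
    & qhbar * qjmath * qkappa = -1].
Proof. by split; rewrite ?expr2; congr Quat => /=; ring. Qed.

End QuatRing.

Definition qnorm (R : realType) (q : quat R) : R :=
  Num.sqrt (quat0 q ^+ 2 + quat1 q ^+ 2 + quat2 q ^+ 2 + quat3 q ^+ 2).

(* [*:] multiplies every entry by the scalar on the left. *)
Definition left_eigenvalue (R : realType) (m : nat)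
    (A : 'M[quat R]_m) (lambda : quat R) : Prop :=
  exists2 x : 'cV[quat R]_m, x != 0 & A *m x = lambda *: x.

(* Main.v *)
(* At an index where the eigenvector x has an entry of maximal norm, the
   eigenvalue equation and multiplicativity of the norm give
   |lambda| |x_i| <= sum_j |a_ij| |x_j| <= (sum_j |a_ij|) |x_i|,
   and |x_i| > 0 cancels. So lambda is bounded by the sum of the norms of all
   the entries of A; 0 serves as the lower bound. *)
Require Import Defs.
From mathcomp Require Import all_boot all_order all_algebra.
From mathcomp Require Import reals.
From mathcomp Require Import ring.

Import Order.TTheory GRing.Theory Num.Theory.
Local Open Scope ring_scope.

Definition qnormsq (R : realType) (q : quat R) : R :=
  quat0 q ^+ 2 + quat1 q ^+ 2 + quat2 q ^+ 2 + quat3 q ^+ 2.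

Lemma qnormsq_ge0 (R : realType) (q : quat R) : 0 <= qnormsq R q.
Proof. by rewrite !addr_ge0 ?sqr_ge0. Qed.

Lemma qnorm_ge0 (R : realType) (q : quat R) : 0 <= qnorm q.
Proof. exact: sqrtr_ge0. Qed.

Lemma sqr_qnorm (R : realType) (q : quat R) : qnorm q ^+ 2 = qnormsq R q.
Proof. exact/sqr_sqrtr/qnormsq_ge0. Qed.

Lemma qnorm0 (R : realType) : qnorm (0 : quat R) = 0.
Proof. by rewrite /qnorm /= expr0n !addr0 sqrtr0. Qed.

Lemma qnorm_gt0 (R : realType) (q : quat R) : q != 0 -> 0 < qnorm q.
Proof.
move=> q0; rewrite sqrtr_gt0 lt0r qnormsq_ge0 andbT.
apply: contra q0; case: q => a b c d /=.
rewrite !paddr_eq0 ?addr_ge0 ?sqr_ge0 // !sqrf_eq0.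
by move=> /andP[/andP[/andP[/eqP-> /eqP->] /eqP->] /eqP->].
Qed.

(* On squared norms this is Euler's four-square identity. *)
Lemma qnormM (R : realType) (p q : quat R) :
  qnorm (p * q) = qnorm p * qnorm q.
Proof.
rewrite /qnorm -sqrtrM ?qnormsq_ge0 //; congr Num.sqrt.
by case: p q => [a b c d] [a' b' c' d'] /=; ring.
Qed.

(** The Euclidean inner product of [R^4], which is half the cross term in the squared norm of a
    sum. *)
Definition qdot (R : realType) (p q : quat R) : R :=
  quat0 p * quat0 q + quat1 p * quat1 q + quat2 p * quat2 q
  + quat3 p * quat3 q.

Lemma qnormsqD (R : realType) (p q : quat R) :
  qnormsq R (p + q) = qnormsq R p + qdot R p q *+ 2 + qnormsq R q.
Proof. by case: p q => [????] [????]; rewrite /qnormsq /qdot /=; ring. Qed.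

(* [qdot p q] is the real part of p times the conjugate of q, a quaternion of
   norm [qnorm p * qnorm q]. *)
Lemma qdot_le (R : realType) (p q : quat R) :
  qdot R p q <= qnorm p * qnorm q.
Proof.
case: q => a b c d.
have -> : qnorm (Quat a b c d) = qnorm (Quat a (- b) (- c) (- d)).
  by rewrite /qnorm /= !sqrrN.
rewrite -qnormM; set r := p * _.
have -> : qdot R p (Quat a b c d) = quat0 r.
  by rewrite /r; case: p {r} => [????]; rewrite /qdot /=; ring.
(* The absolute value of the real part is the root of one of the four squares under the root in
   [qnorm r]. *)
apply: le_trans (ler_norm _) _; rewrite -sqrtr_sqr ler_sqrt ?qnormsq_ge0 //.
by rewrite -!addrA lerDl !addr_ge0 ?sqr_ge0.
Qed.

(** After squaring, the two sides differ only in the cross term, where the Cauchy-Schwarz bound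
    [qdot_le] applies. *)
Lemma ler_qnormD (R : realType) (p q : quat R) :
  qnorm (p + q) <= qnorm p + qnorm q.
Proof.
rewrite -ler_sqr ?nnegrE ?addr_ge0 ?qnorm_ge0 //.
by rewrite sqr_qnorm qnormsqD sqrrD !sqr_qnorm lerD2r lerD2l lerMn2r qdot_le.
Qed.

Lemma ler_qnorm_sum (R : realType) (I : finType) (F : I -> quat R) :
  qnorm (\sum_i F i) <= \sum_i qnorm (F i).
Proof.
elim/big_ind2: _ => [|p a q b pa qb|//]; first by rewrite qnorm0.
exact: le_trans (ler_qnormD _ _ _) (lerD pa qb).
Qed.

Lemma left_eigenvalue_qnorm_le (R : realType) (m : nat) (A : 'M[quat R]_m)
    (lambda : quat R) :
  left_eigenvalue A lambda ->
  exists i, qnorm lambda <= \sum_j qnorm (A i j).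
Proof.
case=> x /matrix0Pn[i0 [k]]; rewrite (ord1 k) => xi0 Ax.
(* The nonzero entry at [i0] shows that there is an index to maximise over, and makes the maximal
   norm positive. *)
have [i _ imax] := @arg_maxP _ _ _ i0 predT (fun i => qnorm (x i 0)) isT.
have xi_gt0 : 0 < qnorm (x i 0).
  exact: lt_le_trans (qnorm_gt0 _ _ xi0) (imax i0 isT).
exists i; rewrite -(ler_pM2r xi_gt0) -qnormM.
have /matrixP/(_ i 0) := Ax; rewrite !mxE => <-.
apply: le_trans (ler_qnorm_sum _ _ _) _; rewrite mulr_suml.
apply: ler_sum => j _; rewrite qnormM ler_wpM2l ?qnorm_ge0 //; exact: imax.
Qed.

Theorem theorem3p3 (R : realType) (m : nat) (A : 'M[quat R]_m) :
  exists lo hi : R,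
    [/\ 0 <= lo, 0 <= hi &
        forall lambda : quat R, left_eigenvalue A lambda ->
          lo <= qnorm lambda <= hi].
Proof.
have row_ge0 i : 0 <= \sum_j qnorm (A i j).
  by apply: sumr_ge0 => j _; exact: qnorm_ge0.
(* The row that bounds an eigenvalue varies with [lambda]; the sum over all rows dominates each of
   them, so one bound serves every eigenvalue. *)
exists 0, (\sum_i \sum_j qnorm (A i j)); split=> //; first exact: sumr_ge0.
move=> lambda /left_eigenvalue_qnorm_le[i le_i]; rewrite qnorm_ge0 /=.
apply: le_trans le_i _; rewrite [leRHS](bigD1 i) //= lerDl.
exact: sumr_ge0.
Qed.
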